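(* Let $M_d,M_a,W$ be finite-dimensional vector spaces, let $f:M_d\times M_a\to M_d$ and $\phi:M_d\times M_a\to W$ define an index 1 DAE $\dot q=f(q,u)$, $0=\phi(q,u)$, and let $a_{ij}$, $b_i>0$ ($1\le i,j\le s$) be Runge--Kutta coefficients with $\tilde a_{ij}=(b_ib_j-b_ja_{ji})/b_i$. Suppose $q_0,q_1,Q^i\in M_d$, $U^i\in M_a$, $p_0,p_1,P^i\in M_d^*$, $\Lambda^i\in W^*$ satisfy $$q_1=q_0+\Delta t\sum_ib_if(Q^i,U^i),\qquad Q^i=q_0+\Delta t\sum_ja_{ij}f(Q^j,U^j),$$ $$p_1=p_0-\Delta t\sum_ib_i\big([D_qf(Q^i,U^i)]^*P^i+[D_q\phi(Q^i,U^i)]^*\Lambda^i\big),$$ $$P^i=p_0-\Delta t\sum_j\tilde a_{ij}\big([D_qf(Q^j,U^j)]^*P^j+[D_q\phi(Q^j,U^j)]^*\Lambda^j\big),$$ $$0=\phi(Q^i,U^i),\qquad 0=[D_uf(Q^i,U^i)]^*P^i+[D_u\phi(Q^i,U^i)]^*\Lambda^i,$$ and suppose $\delta q_0,\delta q_1,\delta Q^i\in M_d$, $\delta U^i\in M_a$ satisfy the discrete variational equations $$\delta q_1=\delta q_0+\Delta t\sum_ib_i\big(D_qf(Q^i,U^i)\delta Q^i+D_uf(Q^i,U^i)\delta U^i\big),$$ $$\delta Q^i=\delta q_0+\Delta t\sum_ja_{ij}\big(D_qf(Q^j,U^j)\delta Q^j+D_uf(Q^j,U^j)\delta U^j\big),$$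 $$0=D_q\phi(Q^i,U^i)\delta Q^i+D_u\phi(Q^i,U^i)\delta U^i.$$ Then $$\langle p_1,\delta q_1\rangle=\langle p_0,\delta q_0\rangle.$$
   Context: All maps are smooth; $\Delta t>0$ is the timestep; $\langle\cdot,\cdot\rangle$ is the duality pairing and $[\cdot]^*$ the dual linear map. Index 1 means $D_u\phi(q,u):M_a\to W$ is invertible at every point where $\phi(q,u)=0$. The first system is the presymplectic Galerkin Hamiltonian variational integrator applied to the adjoint DAE system with Hamiltonian $H(q,u,p,\lambda)=\langle p,f(q,u)\rangle+\langle\lambda,\phi(q,u)\rangle$. *)

(* Defs.v *)
From HB Require Import structures.
From mathcomp Require Import all_boot all_order all_algebra.
From mathcomp Require Import all_classical all_reals all_analysis.

Set Implicit Arguments.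
Unset Strict Implicit.
Unset Printing Implicit Defensive.

Import Order.TTheory GRing.Theory Num.Theory.
Import numFieldNormedType.Exports.

Local Open Scope ring_scope.

(* A finite-dimensional vector space together with a norm inducing its
   topology.  Over a realType all norms on such a space are equivalent, so the
   choice of norm affects neither differentiability nor derivatives. *)
#[short(type="finNormedModType")]
HB.structure Definition FinNormedModule (R : numFieldType) :=
  { V of NormedModule R V & Vector R V }.

HB.instance Definition _ (R : realType) (V W : finNormedModType R) :=
  NormedModule.on (V * W)%type.

(* [Ck k g] : g is k times continuously differentiable.  As V is
   finite-dimensional, the map x |-> 'd g x into the linear maps is C^k iff
   x |-> 'd g x v is C^k for every v. *)
Fixpoint Ck (R : realType) (V W : finNormedModType R) (k : nat) (g : V -> W) :
    Prop :=
  if k is k'.+1 then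
    (forall x : V, differentiable g x) /\
    (forall v : V, Ck k' (fun x : V => 'd g x v))
  else continuous g.

Definition smooth (R : realType) (V W : finNormedModType R) (g : V -> W) : Prop :=
  forall k : nat, Ck k g.

Section PartialDerivatives.
Variables (R : realType) (Md Ma W : finNormedModType R).
Implicit Types (g : Md * Ma -> W) (q : Md) (u : Ma).

Definition Dq g q u : 'Hom(Md, W) := linfun ('d (fun q' : Md => g (q', u)) q).

Definition Du g q u : 'Hom(Ma, W) := linfun ('d (fun u' : Ma => g (q, u')) u).

Definition index1 g : Prop :=
  forall q u, g (q, u) = 0 -> bijective (Du g q u).

End PartialDerivatives.

(* The dual of V is ['Hom(V, R^o)]; in finite dimension every linear form is
   continuous. *)
Definition pairing (R : realType) (V : vectType R) (p : 'Hom(V, R^o)) (v : V) : R :=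
  p v.

Definition dual_map (R : realType) (V W : vectType R) (A : 'Hom(V, W))
    (p : 'Hom(W, R^o)) : 'Hom(V, R^o) :=
  (p \o A)%VF.

(* Symplectic partner of the tableau (a, b): b_i atilde_ij + b_j a_ji = b_i b_j. *)
Definition atilde (R : realType) (s : nat) (a : 'I_s -> 'I_s -> R)
    (b : 'I_s -> R) (i j : 'I_s) : R :=
  (b i * b j - b j * a j i) / b i.

(* Main.v *)
(** The discrete pairing is a bilinear invariant of the partitioned Runge-Kutta
    pair (atilde, a): expanding <p1, x1> around the internal stages leaves the
    stage terms <P_i, v_i> - <g_i, X_i> and a double sum weighted by
    b_i b_j - b_j atilde_ji - b_i a_ij = 0.  The stage terms vanish because the
    u-derivative constraint on the costates and the linearized constraint on the
    variations trade [D_u f]^* P for D_q phi. *)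

Require Import Defs.
From HB Require Import structures.
From mathcomp Require Import all_boot all_order all_algebra.
From mathcomp Require Import all_classical all_reals all_analysis.
From mathcomp Require Import ring.

Import Order.TTheory GRing.Theory Num.Theory.
Import numFieldNormedType.Exports.
Local Open Scope ring_scope.

(** The slopes [v] and [g] stay abstract: the dynamics enters only through the stage balance
    [P i (v i) = g i (X i)]. Symplecticity is stated free of division, so the argument is pure
    bilinear algebra over a field. *)
Lemma partitioned_RK_pairing_invariant {K : fieldType} {V : vectType K}
    {h : K} {s : nat} {a at_ : 'I_s -> 'I_s -> K} {b : 'I_s -> K}
    {x0 : V} {X v : 'I_s -> V} {p0 : 'Hom(V, K^o)} {P g : 'I_s -> 'Hom(V, K^o)} :
  (forall i j, b i * at_ i j + b j * a j i = b i * b j) ->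
  (forall i, X i = x0 + h *: \sum_j a i j *: v j) ->
  (forall i, P i = p0 - h *: \sum_j at_ i j *: g j) ->
  (forall i, P i (v i) = g i (X i)) ->
  (p0 - h *: \sum_i b i *: g i) (x0 + h *: \sum_i b i *: v i) = p0 x0.
Proof.
move=> sympl XE PE stage.
have evalE c (y : V) : (p0 - h *: \sum_j c j *: g j) y
    = p0 y - h * \sum_j c j * g j y.
  rewrite add_lfunE opp_lfunE scale_lfunE sum_lfunE.
  by under eq_bigr do rewrite scale_lfunE.
have linE (l : 'Hom(V, K^o)) c : l (x0 + h *: \sum_j c j *: v j)
    = l x0 + h * \sum_j c j * l (v j).
  rewrite linearD linearZ linear_sum /=.
  by under eq_bigr do rewrite linearZ.
(* Both sides of the stage balance are re-expanded around the initial data [p0] and [x0]. *)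
have stageE i : p0 (v i) - g i x0
    = h * (\sum_j at_ i j * g j (v i) + \sum_j a i j * g i (v j)).
  move: (stage i); rewrite PE XE evalE linE => /eqP.
  by rewrite subr_eq => /eqP ->; ring.
rewrite evalE !linE.
under [X in _ - h * X]eq_bigr do rewrite linE mulrDr.
rewrite big_split /=.
(* Weight [stageE] by [b i] and sum. Swapping indices in the [at_] sum makes the coefficient of
   [g i (v j)] equal to [b j * at_ j i + b i * a i j], which [sympl] turns into [b j * b i]. *)
have dbl : \sum_i b i * (p0 (v i) - g i x0)
    = \sum_i b i * (h * \sum_j b j * g i (v j)).
  under eq_bigr do rewrite stageE mulrCA mulrDr !mulr_sumr.
  under [RHS]eq_bigr do rewrite mulrCA mulr_sumr.
  rewrite -!mulr_sumr big_split /= exchange_big -big_split /=.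
  congr (_ * _); apply: eq_bigr => i _; rewrite -big_split /=.
  apply: eq_bigr => j _.
  by rewrite !mulrA -mulrDl sympl (mulrC (b j)).
have {}dbl : \sum_i b i * p0 (v i) = \sum_i b i * g i x0
    + \sum_i b i * (h * \sum_j b j * g i (v j)).
  by rewrite -dbl -big_split /=; apply: eq_bigr => i _; ring.
by rewrite dbl; ring.
Qed.

Theorem proposition3p2 (R : realType) (Md Ma W : finNormedModType R)
    (f : Md * Ma -> Md) (phi : Md * Ma -> W)
    (f_smooth : smooth f) (phi_smooth : smooth phi) (phi_index1 : index1 phi)
    (dt : R) (dt_gt0 : 0 < dt)
    (s : nat) (a : 'I_s -> 'I_s -> R) (b : 'I_s -> R)
    (b_gt0 : forall i, 0 < b i)
    (q0 q1 : Md) (Q : 'I_s -> Md) (U : 'I_s -> Ma)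
    (p0 p1 : 'Hom(Md, R^o)) (P : 'I_s -> 'Hom(Md, R^o))
    (L : 'I_s -> 'Hom(W, R^o))
    (q1E : q1 = q0 + dt *: \sum_i b i *: f (Q i, U i))
    (QE : forall i, Q i = q0 + dt *: \sum_j a i j *: f (Q j, U j))
    (p1E : p1 = p0 - dt *: \sum_i b i *:
       (dual_map (Dq f (Q i) (U i)) (P i) + dual_map (Dq phi (Q i) (U i)) (L i)))
    (PE : forall i, P i = p0 - dt *: \sum_j atilde a b i j *:
       (dual_map (Dq f (Q j) (U j)) (P j) + dual_map (Dq phi (Q j) (U j)) (L j)))
    (phi0 : forall i, 0 = phi (Q i, U i))
    (LE : forall i, 0 =
       dual_map (Du f (Q i) (U i)) (P i) + dual_map (Du phi (Q i) (U i)) (L i))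
    (dq0 dq1 : Md) (dQ : 'I_s -> Md) (dU : 'I_s -> Ma)
    (dq1E : dq1 = dq0 + dt *: \sum_i b i *:
       (Dq f (Q i) (U i) (dQ i) + Du f (Q i) (U i) (dU i)))
    (dQE : forall i, dQ i = dq0 + dt *: \sum_j a i j *:
       (Dq f (Q j) (U j) (dQ j) + Du f (Q j) (U j) (dU j)))
    (dphi0 : forall i, 0 =
       Dq phi (Q i) (U i) (dQ i) + Du phi (Q i) (U i) (dU i)) :
  pairing p1 dq1 = pairing p0 dq0.
Proof.
rewrite /pairing p1E dq1E.
apply: (partitioned_RK_pairing_invariant _ dQE PE) => i.
  (* Positivity of [b i] cancels the denominator of [atilde]. *)
  by move=> j; rewrite /atilde mulrCA divff ?gt_eqF // mulr1 subrK.
(* Stage balance: the costate constraint at [dU i] and [L i] of the linearized constraint share the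
   term [L i (Du phi (Q i) (U i) (dU i))]; cancelling it matches the [Du f] term with the [Dq phi]
   term. *)
have /(congr1 (fun l : 'Hom(Ma, R^o) => l (dU i))) := LE i.
have /(congr1 (L i)) := dphi0 i.
rewrite /dual_map !add_lfunE !comp_lfunE !linearD linear0 zero_lfunE /= => e1 e2.
congr (_ + _).
by apply: (addIr (L i (Du phi (Q i) (U i) (dU i)))); rewrite -e2 -e1.
Qed.
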